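(* Let $\Bbbk$ be a field with $\operatorname{char}\Bbbk\neq 2$. Let $\mathcal{P}$ be a $2$-unitary operad over $\Bbbk$ of Gelfand-Kirillov dimension $3$ with a $2$-unit $\mathbb{1}_2$. Let $$\mathbb{1}'_2:=\tfrac12\left(\mathbb{1}_2+\mathbb{1}_2*(12)\right)\in\mathcal{P}(2).$$ Then $\mathbb{1}'_2$ is also a $2a$-unit of $\mathcal{P}$. Consequently, $\mathcal{P}$ is $\mathcal{C}om$-augmented.
   Context: An operad is a symmetric operad in $\Bbbk$-vector spaces, with right $\Bbbk\mathbb{S}_n$-modules $\mathcal{P}(n)$ ($n\ge0$; action denoted $*$), identity $\mathbb{1}=\mathbb{1}_1\in\mathcal{P}(1)$ and partial compositions $\circ_i:\mathcal{P}(m)\otimes\mathcal{P}(n)\to\mathcal{P}(m+n-1)$ ($1\le i\le m$, $n\ge0$). All operads are locally finite: $\dim_{\Bbbk}\mathcal{P}(n)<\infty$ for all $n$. The Gelfand-Kirillov dimension is $\operatorname{GKdim}\mathcal{P}=\limsup_{n\to\infty}\log_n\left(\sum_{i=0}^n\dim_{\Bbbk}\mathcal{P}(i)\right)$. An operad is unitary if $\mathcal{P}(0)=\Bbbk\mathbb{1}_0$ is one-dimensional with a chosen basis element $\mathbb{1}_0$ ($0$-unit). A $2$-unitary operad is a unitary operad $\mathcal{P}$ with a chosen element $\mathbb{1}_2\in\mathcal{P}(2)$, called a $2$-unit, such that $\mathbb{1}_2\circ_1\mathbb{1}_0=\mathbb{1}=\mathbb{1}_2\circ_2\mathbb{1}_0$.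 A $2$-unit $\mathbb{1}_2$ is a $2a$-unit if moreover $\mathbb{1}_2\circ_1\mathbb{1}_2=\mathbb{1}_2\circ_2\mathbb{1}_2$. $\mathcal{C}om$ is the operad with $\mathcal{C}om(n)=\Bbbk\mathbb{1}_n$ for all $n\ge0$, trivial symmetric group actions and $\mathbb{1}_m\circ_i\mathbb{1}_n=\mathbb{1}_{m+n-1}$. An operad $\mathcal{P}$ is $\mathcal{C}om$-augmented if there is an operad morphism $\mathcal{C}om\to\mathcal{P}$ (preserving the $0$-unit). *)

(* Defs.v *)
From HB Require Import structures.
From mathcomp Require Import all_boot all_order all_algebra all_fingroup.
From mathcomp Require Import zify.
From mathcomp Require Import all_classical all_reals all_analysis.

Set Implicit Arguments.
Unset Strict Implicit.
Unset Printing Implicit Defensive.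

Import Order.TTheory GRing.Theory Num.Theory.

(** Conventions.  Inputs are numbered from 0, so the partial composition
    [x \circ_(i+1) y] is [opcomp i x y] with [i : 'I_m].

    The right action is the one for which input [j] of [x * s] is input [s j]
    of [x], i.e. [(x * s)(v_1, ..., v_n) = x(v_(s^-1 1), ..., v_(s^-1 n))] in
    an endomorphism operad.  It is a right action for the usual composition of
    permutations, [(x * s) * t = x * (s \o t)]; the product of permutations in
    MathComp is composition in diagrammatic order, [(t * s) j = s (t j)], so
    [s \o t] is written [t * s]. *)

Section GraftPerm.

Definition permn n (s : 'S_n) (k : nat) : nat :=
  if insub k is Some j then val (s j) else k.

(** The input [j != a] of an operation becomes the input [graft_pos n a j] once
    an operation with [n] inputs has been grafted at the input [a]. *)
Definition graft_pos (n a j : nat) : nat := if j < a then j else (j + n).-1.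

Variables (m n : nat) (i : 'I_m) (s : 'S_m) (t : 'S_n).

Definition graft_permn (k : nat) : nat :=
  if k < i then graft_pos n (s i) (permn s k)
  else if k < i + n then s i + permn t (k - i)
  else graft_pos n (s i) (permn s (k - n).+1).

Lemma permnE p (u : 'S_p) (k : nat) (lt_kp : k < p) :
  permn u k = u (Ordinal lt_kp).
Proof. by rewrite /permn insubT. Qed.

Lemma permn_lt p (u : 'S_p) (k : nat) : k < p -> permn u k < p.
Proof. by move=> lt_kp; rewrite permnE. Qed.

Lemma permn_inj p (u : 'S_p) (k l : nat) :
  k < p -> l < p -> permn u k = permn u l -> k = l.
Proof.
by move=> lk ll; rewrite !permnE => /val_inj/perm_inj/(congr1 val).
Qed.

Lemma permn_ord p (u : 'S_p) (j : 'I_p) : permn u j = u j.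
Proof. by rewrite permnE; congr (val (u _)); apply: val_inj. Qed.

Lemma permn_neq (k : nat) : k < m -> k <> i -> permn s k <> s i.
Proof.
by move=> lk nki; rewrite -permn_ord => /(permn_inj lk (ltn_ord i)).
Qed.

Lemma graft_permn_lt (k : nat) : k < (m + n).-1 -> graft_permn k < (m + n).-1.
Proof.
move=> lk; have li := ltn_ord i; have lsi := ltn_ord (s i).
rewrite /graft_permn /graft_pos; case: (ltnP k i) => [ki|ik].
  have := @permn_neq k; have := @permn_lt _ s k; case: ifP; lia.
case: (ltnP k (i + n)) => [kn|nk].
  have := @permn_lt _ t (k - i); lia.
have := @permn_neq (k - n).+1; have := @permn_lt _ s (k - n).+1.
case: ifP; lia.
Qed.

Lemma graft_permn_inj (k l : nat) :
  k < (m + n).-1 -> l < (m + n).-1 -> graft_permn k = graft_permn l -> k = l.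
Proof.
move=> lk ll; have li := ltn_ord i; have lsi := ltn_ord (s i).
have oN j : j < m -> j <> i -> permn s j <> s i := @permn_neq j.
have oI j j' : j < m -> j' < m -> permn s j = permn s j' -> j = j'.
  exact: permn_inj.
have iI j j' : j < n -> j' < n -> permn t j = permn t j' -> j = j'.
  exact: permn_inj.
have iL j : j < n -> permn t j < n by exact: permn_lt.
have posI j j' : j < m -> j' < m -> j <> i -> j' <> i ->
    graft_pos n (s i) (permn s j) = graft_pos n (s i) (permn s j') -> j = j'.
  move=> lj lj' nj nj'; have := oN _ lj nj; have := oN _ lj' nj'.
  have := oI _ _ lj lj'; rewrite /graft_pos.
  by do 2![case: ifP]; lia.
have posN j j' : j < m -> j <> i -> j' < n ->
    graft_pos n (s i) (permn s j) <> s i + permn t j'.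
  move=> lj nj lj'; have := oN _ lj nj; have := iL _ lj'.
  by rewrite /graft_pos; case: ifP; lia.
rewrite /graft_permn.
case: (ltnP k i) => [ki|ik]; [|case: (ltnP k (i + n)) => [kn|nk]];
  (case: (ltnP l i) => [lti|il]; [|case: (ltnP l (i + n)) => [ln|nl]]).
- by apply: posI; lia.
- by move/posN; lia.
- by move/posI; lia.
- by move/esym/posN; lia.
- by move/addnI/iI; lia.
- by move/esym/posN; lia.
- by move/posI; lia.
- by move/posN; lia.
- by move/posI; lia.
Qed.

Definition graft_ord (k : 'I_(m + n).-1) : 'I_(m + n).-1 :=
  Ordinal (graft_permn_lt (ltn_ord k)).

Lemma graft_ord_inj : injective graft_ord.
Proof.
move=> k l /(congr1 val) /= /graft_permn_inj kl.
by apply: val_inj; apply: kl.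
Qed.

(** The partial composition [s \circ_i t] of permutations, in the convention
    above: outer inputs move by [s], the inputs of the block inserted at [i]
    move by [t], and the block itself moves from [i] to [s i]. *)
Definition graft_perm : 'S_(m + n).-1 := perm graft_ord_inj.

Lemma graft_permE (k : 'I_(m + n).-1) : graft_perm k = graft_permn k :> nat.
Proof. by rewrite permE. Qed.

End GraftPerm.

(** Local finiteness is part of the structure: [vectType] is the library's type
    of finite-dimensional spaces.  The casts are forced by arities that are
    equal but not convertible; as equality proofs on [nat] are unique, it does
    not matter that they are quantified. *)
Record operad (k : fieldType) := Operad {
  component :> nat -> vectType k;
  opact : forall n, component n -> 'S_n -> component n;
  opid : component 1;
  opcomp : forall m n, 'I_m -> component m -> component n ->
    component (m + n).-1;
  opact_linear : forall n (s : 'S_n), linear (fun x => opact x s);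
  opact_id : forall n (x : component n), opact x 1%g = x;
  opact_act : forall n (x : component n) (s t : 'S_n),
    opact (opact x s) t = opact x (t * s)%g;
  opcomp_linearl : forall m n (i : 'I_m) (y : component n),
    linear (fun x : component m => opcomp i x y);
  opcomp_linearr : forall m n (i : 'I_m) (x : component m),
    linear (fun y : component n => opcomp i x y);
  opcomp_idl : forall n (i : 'I_1) (y : component n), opcomp i opid y = y;
  opcomp_idr : forall m (i : 'I_m) (x : component m) (e : (m + 1).-1 = m),
    ecast p (component p) e (opcomp i x opid) = x;
  opcomp_seq : forall l m n (i : 'I_l) (j : 'I_m) (ij : 'I_(l + m).-1)
      (x : component l) (y : component m) (z : component n)
      (e : (l + (m + n).-1).-1 = ((l + m).-1 + n).-1),
    ij = i + j :> nat ->
    opcomp ij (opcomp i x y) z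
      = ecast p (component p) e (opcomp i x (opcomp j y z));
  opcomp_par : forall l m n (i j : 'I_l) (j' : 'I_(l + m).-1)
      (i' : 'I_(l + n).-1)
      (x : component l) (y : component m) (z : component n)
      (e : ((l + n).-1 + m).-1 = ((l + m).-1 + n).-1),
    i < j -> j' = (j + m).-1 :> nat -> i' = i :> nat ->
    opcomp j' (opcomp i x y) z
      = ecast p (component p) e (opcomp i' (opcomp j x z) y);
  opcomp_act : forall m n (i : 'I_m) (x : component m) (y : component n)
      (s : 'S_m) (t : 'S_n),
    opcomp i (opact x s) (opact y t) = opact (opcomp (s i) x y) (graft_perm i s t)
}.

Arguments opid {k} o.

Record operad_morphism (k : fieldType) (P Q : operad k) := OperadMorphism {
  mor :> forall n, {linear P n -> Q n};
  mor_id : mor 1 (opid P) = opid Q;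
  mor_act : forall n (x : P n) (s : 'S_n), mor n (opact x s) = opact (mor n x) s;
  mor_opcomp : forall m n (i : 'I_m) (x : P m) (y : P n),
    mor (m + n).-1 (opcomp i x y) = opcomp i (mor m x) (mor n y)
}.

Section Com.

Local Open Scope ring_scope.

Variable k : fieldType.

Lemma ecast_const (T : Type) (a b : nat) (e : a = b) (x : T) :
  ecast p ((fun=> T) p) e x = x.
Proof. by case: _ / e. Qed.

Let com_space (n : nat) : vectType k := k^o.

(** [Com n] is the line [k^o]; its basis element [\1_n] is [1]. *)
Definition Com : operad k.
Proof.
refine (@Operad k com_space (fun _ x _ => x) (1 : k^o)
  (fun m n i x y => (x : k) * (y : k)) _ _ _ _ _ _ _ _ _ _).
- by [].
- by [].
- by [].
- by move=> m n i y a u v /=; rewrite mulrDl -[RHS]/(a * (u * y) + v * y) mulrA.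
- by move=> m n i x a u v /=; rewrite mulrDr -[RHS]/(a * (x * u) + x * v) mulrCA.
- by move=> n i y; rewrite mul1r.
- by move=> m i x e; rewrite ecast_const mulr1.
- by move=> l m n i j ij x y z e _; rewrite ecast_const mulrA.
- by move=> l m n i j j' i' x y z e _ _ _; rewrite ecast_const mulrAC.
- by [].
Defined.

Definition com_unit (n : nat) : Com n := (1 : k^o).

End Com.

Section Unitary.

Variables (k : fieldType) (P : operad k).

Definition is_unit0 (u0 : P 0) : Prop :=
  u0 != 0%R /\ <[u0]>%VS = {: P 0%N}%VS.

Definition is_2unit (u0 : P 0) (u2 : P 2) : Prop :=
  opcomp (ord0 : 'I_2) u2 u0 = opid P /\
  opcomp (ord_max : 'I_2) u2 u0 = opid P.

Definition is_2aunit (u0 : P 0) (u2 : P 2) : Prop :=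
  is_2unit u0 u2 /\
  opcomp (ord0 : 'I_2) u2 u2 = opcomp (ord_max : 'I_2) u2 u2.

Definition com_augmented (u0 : P 0) : Prop :=
  exists f : operad_morphism (Com k) P, f 0 (com_unit k 0) = u0.

(** For the zero operad the logarithm of the sum would be [-oo], while
    [ln 0 = 0]; for a unitary operad the sum is at least 1.  The values at
    [n = 0, 1], where [ln n = 0], do not affect the limsup. *)
Definition GKdim (R : realType) : \bar R :=
  limn_esup (fun n : nat =>
    (ln (\sum_(i < n.+1) \dim {: P i})%:R / ln n%:R)%R%:E).

End Unitary.

Arguments GKdim {k} P R.

(* Main.v *)
(** Let D_j : P(n+1) -> P(n) plug the 0-unit into input j. A 2-unit provides
    degeneracies P(n) -> P(n+1) (multiply by a new first variable, or double an
    input), and together they satisfy the simplicial identities. As in the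
    Dold-Kan decomposition, if N_r(n) is the common kernel of D_0, ..., D_(r-1)
    on P(n), then D_r maps N_r(n+1) onto N_r(n); so a nonzero x in P(d) killed by
    all D_j forces dim P(n) >= C(n, d) for all n, hence GKdim P > d. For
    GKdim P = 3, operations of arity at least 3 are therefore determined by their
    images under the D_j. Starting from a symmetric 2-unit, the iterated products
    1_n satisfy D_j 1_(n+1) = 1_n, and by induction on the arity this yields
    1_m o_i 1_n = 1_(m+n-1) and 1_n * s = 1_n. *)

Require Import Defs.
From HB Require Import structures.
From mathcomp Require Import all_boot all_order all_algebra all_fingroup.
From mathcomp Require Import zify lra.
From mathcomp Require Import all_classical all_reals all_analysis.
Import Order.TTheory GRing.Theory Num.Theory.
Local Open Scope ring_scope.

Set Implicit Arguments.
Unset Strict Implicit.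
Unset Printing Implicit Defensive.

(** * Partial composition on operations of arbitrary arity *)

Section Operations.

Variables (k : fieldType) (P : operad k).

(** Bundling an operation with its arity makes the operad axioms free of casts. *)
Definition operation := {n : nat & P n}.

Definition op n (x : P n) : operation := existT (fun n => P n : Type) n x.

Definition arity (x : operation) : nat := projT1 x.

(** Junk value [x] when [x] has no input [i]. *)
Definition graft (i : nat) (x y : operation) : operation :=
  if insub i is Some j then op (opcomp (j : 'I_(arity x)) (projT2 x) (projT2 y))
  else x.

Lemma op_inj n : injective (@op n).
Proof. by move=> x y; apply: Eqdep_dec.inj_pair2_eq_dec; apply: eq_comparable. Qed.

Lemma op_ecast m n (e : m = n) (x : P m) : op (ecast p (P p) e x) = op x.
Proof. by case: _ / e. Qed.

Lemma op_opcomp m n (i : 'I_m) (x : P m) (y : P n) :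
  op (opcomp i x y) = graft i (op x) (op y).
Proof. by rewrite /graft valK. Qed.

Lemma arity_graft i x y :
  (i < arity x)%N -> arity (graft i x y) = (arity x + arity y).-1.
Proof. by case: x => m x lt_im; rewrite /graft insubT. Qed.

Lemma graft_idl (x : operation) : graft 0 (op (opid P)) x = x.
Proof.
by case: x => n x; rewrite -(op_opcomp (ord0 : 'I_1)) opcomp_idl.
Qed.

Lemma graft_idr i (x : operation) :
  (i < arity x)%N -> graft i x (op (opid P)) = x.
Proof.
case: x => m x lt_im; rewrite -(op_opcomp (Ordinal lt_im)).
have e : (m + 1).-1 = m by rewrite addn1.
by rewrite -(op_ecast e) opcomp_idr.
Qed.

Lemma graft_seq i j x y z : (i < arity x)%N -> (j < arity y)%N ->
  graft (i + j) (graft i x y) z = graft i x (graft j y z).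
Proof.
case: x y z => l x [m y] [n z] /= lt_il lt_jm.
have ltij : (i + j < (l + m).-1)%N by lia.
have e : (l + (m + n).-1).-1 = ((l + m).-1 + n).-1 by lia.
have /(congr1 (@op _)) := @opcomp_seq _ P l m n (Ordinal lt_il) (Ordinal lt_jm)
  (Ordinal ltij) x y z e erefl.
by rewrite op_ecast !op_opcomp.
Qed.

Lemma graft_par i j x y z : (i < j)%N -> (j < arity x)%N ->
  graft (j + arity y).-1 (graft i x y) z = graft i (graft j x z) y.
Proof.
case: x y z => l x [m y] [n z] /= lt_ij lt_jl.
have lt_il := ltn_trans lt_ij lt_jl.
have lt_j' : ((j + m).-1 < (l + m).-1)%N by lia.
have lt_i' : (i < (l + n).-1)%N by lia.
have e : ((l + n).-1 + m).-1 = ((l + m).-1 + n).-1 by lia.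
have /(congr1 (@op _)) := @opcomp_par _ P l m n (Ordinal lt_il) (Ordinal lt_jl)
  (Ordinal lt_j') (Ordinal lt_i') x y z e lt_ij erefl erefl.
by rewrite op_ecast !op_opcomp.
Qed.

Definition op_zero (x : operation) : Prop := projT2 x = 0.

Lemma op_zero_eq0 n (x : P n) : op_zero (op x) -> x = 0.
Proof. by []. Qed.

Section Linearity.

Variables (m n : nat) (i : 'I_m).

Definition opcompl (y : P n) (x : P m) : P (m + n).-1 := opcomp i x y.

HB.instance Definition _ (y : P n) :=
  GRing.isLinear.Build k (P m) (P (m + n).-1) *:%R (opcompl y)
    (opcomp_linearl i y).

HB.instance Definition _ (x : P m) :=
  GRing.isLinear.Build k (P n) (P (m + n).-1) *:%R (opcomp i x)
    (opcomp_linearr i x).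

Lemma opcompZl (a : k) (x : P m) (y : P n) :
  opcomp i (a *: x) y = a *: opcomp i x y.
Proof. exact: (linearZZ (opcompl y)). Qed.

Lemma opcompDl (x x' : P m) (y : P n) :
  opcomp i (x + x') y = opcomp i x y + opcomp i x' y.
Proof. exact: (linearD (opcompl y)). Qed.

Lemma opcompZr (a : k) (x : P m) (y : P n) :
  opcomp i x (a *: y) = a *: opcomp i x y.
Proof. exact: linearZZ. Qed.

Lemma opcomp0l (y : P n) : opcomp i (0 : P m) y = 0.
Proof. exact: (linear0 (opcompl y)). Qed.

Lemma opcomp0r (x : P m) : opcomp i x (0 : P n) = 0.
Proof. exact: linear0. Qed.

End Linearity.

Section ActionLinearity.

Variables (n : nat) (s : 'S_n).

Definition act_by (x : P n) : P n := opact x s.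

HB.instance Definition _ :=
  GRing.isLinear.Build k (P n) (P n) *:%R act_by (opact_linear s).

Lemma opactZ (a : k) (x : P n) : opact (a *: x) s = a *: opact x s.
Proof. exact: (linearZZ act_by). Qed.

Lemma opactD (x y : P n) : opact (x + y) s = opact x s + opact y s.
Proof. exact: (linearD act_by). Qed.

End ActionLinearity.

Lemma graft0l i x y : op_zero x -> op_zero (graft i x y).
Proof.
case: x => m x; rewrite /op_zero /graft /= => ->; case: insub => //= j.
exact: opcomp0l.
Qed.

Lemma graft0r i x y : (i < arity x)%N -> op_zero y -> op_zero (graft i x y).
Proof.
case: x y => m x [n y] lt_im; rewrite /op_zero /= => ->.
rewrite -(op_opcomp (Ordinal lt_im)).
exact: opcomp0r.
Qed.

End Operations.

(** * Restrictions, degeneracies and the dimension bound *)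

Section Unital.

Variables (k : fieldType) (P : operad k) (u0 : P 0%N) (u2 : P 2%N).
Hypothesis hu2 : is_2unit u0 u2.

Lemma ecast_linear m n (e : m = n) : linear (fun x => ecast p (P p) e x).
Proof. by case: _ / e. Qed.

Definition restr i n (x : P n.+1) : P n :=
  ecast p (P p) (addn0 n) (opcomp (inord i : 'I_n.+1) x u0).

Fact restr_linear i n : linear (@restr i n).
Proof. by move=> a x y; rewrite /restr opcomp_linearl ecast_linear. Qed.

HB.instance Definition _ i n :=
  GRing.isLinear.Build k (P n.+1) (P n) *:%R (@restr i n) (@restr_linear i n).

(** Indices are shifted by one: [degen 0] is the extra degeneracy and [degen i.+1] the usual s_i.
    Hence [restr i] undoes both [degen i] and [degen i.+1]. *)
Definition degen i n (y : P n.+1) : P n.+2 :=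
  if i is j.+1 then ecast p (P p) (addn2 n) (opcomp (inord j : 'I_n.+1) y u2)
  else opcomp (ord_max : 'I_2) u2 y.

Arguments degen : simpl never.

Lemma op_restr i n (x : P n.+1) :
  (i <= n)%N -> op (restr i x) = graft i (op x) (op u0).
Proof.
by move=> le_in; rewrite op_ecast -{2}(@inordK n i) // -op_opcomp.
Qed.

Lemma op_degen0 n (y : P n.+1) : op (degen 0 y) = graft 1 (op u2) (op y).
Proof. by rewrite -(op_opcomp (ord_max : 'I_2)). Qed.

Lemma op_degenS i n (y : P n.+1) :
  (i <= n)%N -> op (degen i.+1 y) = graft i (op y) (op u2).
Proof.
by move=> le_in; rewrite op_ecast -{2}(@inordK n i) // -op_opcomp.
Qed.

Lemma graft_unit0 : graft 0 (op u2) (op u0) = op (opid P).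
Proof. by rewrite -hu2.1 (op_opcomp (ord0 : 'I_2)). Qed.

Lemma graft_unit1 : graft 1 (op u2) (op u0) = op (opid P).
Proof. by rewrite -hu2.2 (op_opcomp (ord_max : 'I_2)). Qed.

Lemma restr_degen i n (y : P n.+1) :
  (i <= n.+1)%N -> restr i (degen i y) = y.
Proof.
move=> le_in; apply: op_inj; rewrite op_restr //.
case: i le_in => [|i] le_in.
  rewrite op_degen0 -(@graft_par _ _ 0 1 (op u2) (op u0)) //.
  by rewrite graft_unit0 graft_idl.
rewrite op_degenS // -addn1 graft_seq // graft_unit1 graft_idr //.
Qed.

Lemma restr_degenS i n (y : P n.+1) :
  (i <= n)%N -> restr i (degen i.+1 y) = y.
Proof.
move=> le_in; apply: op_inj; rewrite op_restr ?leqW // op_degenS //.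
by rewrite -{1}[i]addn0 graft_seq // graft_unit0 graft_idr.
Qed.

(** The identity exchanging a restriction with a degeneracy is recorded only where the restriction
    vanishes; in general it would apply [degen] to [restr j y], whose arity may be 0. *)
Lemma restr_degen_lt i j n (y : P n.+1) :
  (j.+1 < i <= n.+1)%N -> restr j y = 0 -> restr j (degen i y) = 0.
Proof.
case: i => // i /andP[lt_ji le_in] yj0; apply: op_zero_eq0.
rewrite op_restr ?op_degenS -?(@graft_par _ _ j i _ (op u0)) //; last by lia.
by apply: graft0l; rewrite -op_restr ?yj0 //; lia.
Qed.

Lemma restr_degen_gt i j n (y : P n.+1) :
  (i <= j <= n)%N -> restr j y = 0 -> restr j.+1 (degen i y) = 0.
Proof.
move=> /andP[le_ij le_jn] yj0; apply: op_zero_eq0; rewrite op_restr //.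
case: i le_ij => [|i] lt_ij.
  rewrite op_degen0 (@graft_seq _ _ 1) //.
  by apply: graft0r; rewrite // -op_restr ?yj0.
rewrite op_degenS; last by lia.
have -> : j.+1 = (j + arity (op u2)).-1 by rewrite /= addn2.
rewrite graft_par //.
by apply: graft0l; rewrite -op_restr ?yj0.
Qed.

(* The lift is the alternating sum of the degeneracies [degen i y], [i <= r]. *)
Lemma restr_lift r n (y : P n.+1) : (r <= n.+1)%N ->
  (forall j, (j < r)%N -> restr j y = 0) ->
  exists x : P n.+2, [/\ restr r x = y,
    forall j, (j < r)%N -> restr j x = 0 &
    forall j, (r <= j <= n)%N -> restr j y = 0 -> restr j.+1 x = 0].
Proof.
elim: r => [|r IHr] le_rn y0.
  exists (degen 0 y); split=> // [|j]; first exact: restr_degen.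
  exact: restr_degen_gt.
have [|x [xr x_lt x_gt]] := IHr (ltnW le_rn); first by move=> j /ltnW/y0.
exists (degen r.+1 y - x); split.
(* The last clause of the induction hypothesis, at [j = r], kills [restr r.+1 x]; at index [r] the
   two terms of the difference both restrict to [y]. *)
- rewrite linearB /= restr_degen // x_gt ?subr0 ?y0 //; lia.
- move=> j; rewrite ltnS leq_eqVlt linearB /= => /orP[/eqP ->|lt_jr].
    by rewrite restr_degenS // xr subrr.
  by rewrite restr_degen_lt ?x_lt ?subr0 ?y0 //; lia.
- move=> j le_rj yj; rewrite linearB /= restr_degen_gt // x_gt ?subr0 //; lia.
Qed.

(** This is N_r(n + 1): the second argument is one less than the arity. *)
Definition normalized r n : {vspace P n.+1} :=
  (\bigcap_(i < r) lker (linfun (@restr i n)))%VS.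

Lemma normalizedP r n (x : P n.+1) :
  reflect (forall i, (i < r)%N -> restr i x = 0) (x \in normalized r n).
Proof.
rewrite memvE; apply: (iffP subv_bigcapP) => x0 i.
  move=> lt_ir; have := x0 (Ordinal lt_ir) isT.
  by rewrite -memvE memv_ker lfunE => /eqP.
by move=> _; rewrite -memvE memv_ker lfunE /= x0.
Qed.

(** Rank-nullity for [restr r] on [normalized r n.+1]: the kernel is [normalized r.+1 n.+1], and by
    [restr_lift] the image contains [normalized r n]. *)
Lemma dim_normalizedS r n : (r <= n.+1)%N ->
  (\dim (normalized r n) + \dim (normalized r.+1 n.+1)
     <= \dim (normalized r n.+1))%N.
Proof.
move=> le_rn; rewrite -(limg_ker_dim (linfun (@restr r n.+1)) (normalized r _)) addnC.
rewrite {1}/normalized big_ord_recr /= leq_add2l dimvS //.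
apply/subvP => y /normalizedP y0.
have [x [<- x0 _]] := restr_lift le_rn y0.
by have /(memv_img (linfun (@restr r n.+1))) : x \in normalized r n.+1;
  [apply/normalizedP | rewrite lfunE].
Qed.

(** [dim_normalizedS] has the shape of Pascal's rule. For [m = 0] each space contains [x]; for
    [q = 0] the dimension does not decrease with the arity. *)
Lemma dim_normalized_ge d (x : P d.+1) : x != 0 ->
  (forall i, (i <= d)%N -> restr i x = 0) ->
  forall m q, (q <= d.+1)%N ->
  ('C(m + q, q) <= \dim (normalized (d.+1 - q) (m + d)))%N.
Proof.
move=> x_neq0 x0; elim=> [|m IHm] q le_qd.
  rewrite add0n binn lt0n dimv_eq0; apply: contraNneq x_neq0 => N0.
  rewrite -memv0 -N0; apply/normalizedP => i lt_i; apply: x0; lia.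
elim: q le_qd => [_|q IHq lt_qd].
  have := IHm 0%N isT; rewrite !bin0 => /leq_trans; apply.
  have le_dm : (d.+1 - 0 <= (m + d).+1)%N by lia.
  exact: leq_trans (leq_addr _ _) (dim_normalizedS le_dm).
rewrite addnS binS {1}addSnnS.
have le_qm : (d.+1 - q.+1 <= (m + d).+1)%N by lia.
apply: leq_trans (dim_normalizedS le_qm).
by rewrite subnSK //; apply: leq_add; [apply: IHm | apply/IHq/ltnW].
Qed.

Lemma dim_ge_bin d (x : P d.+1) : x != 0 ->
  (forall i, (i <= d)%N -> restr i x = 0) ->
  forall n, ('C(n, d.+1) <= \dim {: P n})%N.
Proof.
move=> x_neq0 x0 n; case: (ltnP n d.+1) => [/bin_small -> //|le_dn].
rewrite -(subnK le_dn) addnS; move: (n - d.+1)%N => m.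
(* At [q = d.+1] no restriction is required to vanish. *)
have := dim_normalized_ge x_neq0 x0 m (leqnn _); rewrite addnS => /leq_trans.
by apply; apply/dimvS/subvf.
Qed.

End Unital.

(** * From binomial dimension bounds to Gelfand-Kirillov dimension *)

Section Growth.

Lemma sum_bin_col n d : (\sum_(i < n) 'C(i, d) = 'C(n, d.+1))%N.
Proof.
by elim: n => [|n IHn]; rewrite ?big_ord0 // big_ord_recr /= IHn binS.
Qed.

Lemma exp_sub_le_ffact n m : ((n - m) ^ m <= n ^_ m)%N.
Proof.
elim: m n => [|m IHm] n; first by rewrite ffactn0.
rewrite ffactnS expnS leq_mul ?leq_subr // -subn1.
by apply: leq_trans (IHm _); rewrite -subnDA.
Qed.

(** Each factor of the falling factorial of [n.+1] is at least [n - d], hence at least half of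
    [n]. *)
Lemma exp_le_bin n d : (d.*2 <= n)%N ->
  (n ^ d.+1 <= 2 ^ d.+1 * d.+1`! * 'C(n.+1, d.+1))%N.
Proof.
move=> le_dn; rewrite -mulnA [(_`! * _)%N]mulnC bin_ffact.
apply: leq_trans (leq_mul (leqnn _) (exp_sub_le_ffact _ _)).
by rewrite -expnMn leq_exp2r //; lia.
Qed.

Lemma limn_esup_ge (R : realType) (u : (\bar R)^nat) (a : \bar R) (N : nat) :
  (forall n, (N <= n)%N -> (a <= u n)%E) -> (a <= limn_esup u)%E.
Proof.
move=> le_au; rewrite limn_esup_lim; apply: lime_ge; first exact: is_cvg_esups.
exists N => // n /= le_Nn; apply: le_trans (le_au n le_Nn) _.
by apply: ereal_sup_ubound; exists n => /=.
Qed.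

Lemma GKdim_gt (R : realType) (k : fieldType) (P : operad k) d :
  (forall n, ('C(n, d) <= \dim {: P n})%N) -> ((d%:R : R)%:E < GKdim P R)%E.
Proof.
move=> le_dim; pose c := (2 ^ d.+1 * d.+1`!)%N.
have c_gt0 : (0 < c)%N by rewrite muln_gt0 expn_gt0 fact_gt0.
(* Summing over arities raises the degree to [d.+1]; giving up 1/2 in the exponent absorbs the
   constant [c]. *)
apply: (@lt_le_trans _ _ (d%:R + 2^-1 : R)%:E); first by rewrite lte_fin; lra.
(* The three terms serve [exp_le_bin], the bound [2 ln c <= ln n], and [ln n > 0]. *)
apply: (@limn_esup_ge _ _ _ (d.*2 + c ^ 2 + 2)) => n le_n.
rewrite lee_fin /=; set S := (\sum_(i < _) _)%N.
have le_nS : (n ^ d.+1 <= c * S)%N.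
  apply: leq_trans (exp_le_bin _) _; first by lia.
  rewrite leq_mul // -sum_bin_col; apply: leq_sum => i _; exact: le_dim.
have n_gt0 : (0 < n)%N by lia.
have S_gt0 : (0 < S)%N.
  by case: posnP le_nS => // ->; rewrite muln0 leqn0 expn_eq0; case: (n) n_gt0.
have cS_gt0 : (0 < c * S)%N by rewrite muln_gt0 c_gt0.
have ln_gt0 : 0 < ln (n%:R : R) by rewrite ln_gt0 // ltr1n; lia.
have le_cn : ln (c%:R : R) *+ 2 <= ln n%:R.
  rewrite -lnXn ?ltr0n // ler_ln ?posrE ?exprn_gt0 ?ltr0n // -natrX ler_nat.
  by lia.
have le_ln : (d%:R + 1) * ln (n%:R : R) <= ln c%:R + ln S%:R.
  rewrite natr1 mulr_natl -lnXn ?ltr0n // -lnM ?posrE ?ltr0n // ler_ln ?posrE ?exprn_gt0 //;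
    rewrite -?natrX -?natrM ?ltr0n ?ler_nat ?expn_gt0 ?n_gt0 //.
rewrite ler_pdivlMr //; lra.
Qed.

End Growth.

(** * The morphism from [Com] given by a symmetric 2-unit *)

Section ComOfUnit.

Variables (k : fieldType) (P : operad k) (u0 : P 0%N) (mu : P 2%N).
Hypothesis mu_unit : is_2unit u0 mu.
Hypothesis mu_sym : opact mu (tperm ord0 ord_max) = mu.
Hypothesis restr_inj0 : forall d (x : P d.+1), (2 <= d)%N ->
  (forall i, (i <= d)%N -> restr u0 i x = 0) -> x = 0.

(** Right-nested products ending in [u0]; starting at arity 0 makes arity 1 the identity by the unit
    law. *)
Fixpoint com_elt n : P n :=
  if n is m.+1 then opcomp (ord_max : 'I_2) mu (com_elt m) else u0.

Arguments com_elt : simpl never.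

Lemma op_com_eltS n : op (com_elt n.+1) = graft 1 (op mu) (op (com_elt n)).
Proof. by rewrite -(op_opcomp (ord_max : 'I_2)). Qed.

Lemma com_elt1 : com_elt 1 = opid P.
Proof. exact: mu_unit.2. Qed.

Lemma com_elt2 : com_elt 2 = mu.
Proof. by apply: op_inj; rewrite op_com_eltS com_elt1 graft_idr. Qed.

Lemma graft_com_elt0 i n :
  (i <= n)%N -> graft i (op (com_elt n.+1)) (op u0) = op (com_elt n).
Proof.
elim: n i => [|n IHn] [|i] // lt_in; rewrite op_com_eltS.
- by rewrite (graft_unit1 mu_unit) graft_idl.
- rewrite -(@graft_par _ _ 0 1 (op mu) (op u0)) //.
  by rewrite (graft_unit0 mu_unit) graft_idl.
- by rewrite (@graft_seq _ _ 1) // IHn // op_com_eltS.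
Qed.

(** Injectivity of the restrictions in the form used below: plugging in [u0] lowers the arity, which
    allows induction. *)
Lemma com_elt_unique (x : operation P) : (2 < arity x)%N ->
  (forall i, (i < arity x)%N ->
     graft i x (op u0) = op (com_elt (arity x).-1)) ->
  x = op (com_elt (arity x)).
Proof.
case: x => [[|[|[|n]]] x] // _ eq_x; congr (op _).
apply/eqP; rewrite -subr_eq0; apply/eqP/restr_inj0 => // i le_in.
rewrite linearB /=; apply/eqP; rewrite subr_eq0; apply/eqP/op_inj.
by rewrite !op_restr // graft_com_elt0 //; apply: eq_x.
Qed.

Lemma graft_com_elt i m n : (i < m)%N ->
  graft i (op (com_elt m)) (op (com_elt n)) = op (com_elt (m + n).-1).
Proof.
have [N] := ubnP (m + n); elim: N => // N IHN in i m n *.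
rewrite ltnS => le_mnN lt_im.
(* Results of arity at most 2 are out of reach of [com_elt_unique]; there one factor is [u0] or the
   identity. *)
have [mn_small|mn_big] := leqP (m + n)%N 3.
  case: n le_mnN mn_small => [|[|n]] le_mnN mn_small.
  - case: m lt_im {le_mnN mn_small} => // m lt_im.
    by rewrite graft_com_elt0 // addn0.
  - by rewrite com_elt1 graft_idr // addn1.
  - have [-> ->] : m = 1 /\ i = 0 by lia.
    by rewrite com_elt1 graft_idl.
have <- : arity (graft i (op (com_elt m)) (op (com_elt n))) = (m + n).-1.
  exact: arity_graft.
apply: com_elt_unique; rewrite arity_graft //=; first by lia.
case: m => // m in le_mnN lt_im mn_big * => j lt_jmn.
(* Input [j] lies before, inside or after the grafted block; in each case [u0] moves into one factor
   and lowers [m + n] by one. *)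
have [lt_ji|le_ij] := ltnP j i.
  case: i => // i in lt_im lt_ji *.
  rewrite -(@graft_par _ _ j i.+1 _ (op u0)) // graft_com_elt0; last by lia.
  case: m => // m in le_mnN lt_im mn_big lt_jmn *.
  by rewrite /= addn0 IHN //; lia.
have [lt_jin|le_inj] := ltnP j (i + n).
  case: n => [|n] in le_mnN mn_big lt_jmn lt_jin *; first by lia.
  rewrite -(subnKC le_ij) graft_seq // ?graft_com_elt0 ?IHN //=; try lia.
  by rewrite !addnS.
have -> : j = ((j - n).+1 + arity (op (com_elt n))).-1 by rewrite /=; lia.
rewrite graft_par ?graft_com_elt0 ?IHN //=; lia.
Qed.

Lemma perm_ord2 (s : 'S_2) : s = 1%g \/ s = tperm ord0 ord_max.
Proof.
have ordP (i : 'I_2) : i = ord0 \/ i = ord_max.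
  by case: i => [[|[|//]]] lt_i2; [left | right]; apply: val_inj.
have neq : s ord0 <> s ord_max by move/perm_inj.
case: (ordP (s ord0)) (ordP (s ord_max)) neq => s0 [] s1; rewrite s0 s1 // => _.
- by left; apply/permP => i; rewrite perm1; case: (ordP i) => ->.
- by right; apply/permP => i; case: (ordP i) => ->; rewrite ?tpermL ?tpermR.
Qed.

(** By [opcomp_act], plugging [u0] into a permuted product gives a permuted product of smaller
    arity. Arity 2 is [mu_sym]. *)
Lemma opact_com_elt n (s : 'S_n) : opact (com_elt n) s = com_elt n.
Proof.
elim: n s => [|n IHn] s.
  by rewrite (_ : s = 1%g) ?opact_id //; apply/permP => -[].
case: n => [|[|n]] in IHn s *.
- rewrite (_ : s = 1%g) ?opact_id //; apply/permP => i.
  by rewrite perm1 [s i]ord1 [i]ord1.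
- by rewrite com_elt2; case: (perm_ord2 s) => ->; rewrite ?opact_id.
apply: op_inj; apply: com_elt_unique => // i /= lt_in.
(* The arity [p] is arbitrary because [(n.+3 + 0).-1] is not convertible to [n.+2]. *)
have opactP p (z : P p) (t : 'S_p) :
    op z = op (com_elt n.+2) -> op (opact z t) = op (com_elt n.+2).
  move=> eq_z; have eq_p : p = n.+2 := congr1 (@arity _ _) eq_z.
  by move: z t eq_z; rewrite eq_p => z t /op_inj ->; rewrite IHn.
have /(congr1 (@op _ _ _)) :=
  opcomp_act (Ordinal lt_in) (com_elt n.+3) u0 s 1%g.
rewrite opact_id op_opcomp /= => ->; apply: opactP.
have le_sn : (s (Ordinal lt_in) <= n.+2)%N by rewrite -ltnS.
by rewrite -(graft_com_elt0 le_sn) -op_opcomp.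
Qed.

Definition com_map n (a : Com k n) : P n := (a : k) *: com_elt n.

Fact com_map_linear n : linear (@com_map n).
Proof.
by move=> a x y; rewrite /com_map [LHS]scalerDl -scalerA.
Qed.

HB.instance Definition _ n :=
  GRing.isLinear.Build k (Com k n) (P n) *:%R (@com_map n) (@com_map_linear n).

Lemma com_augmented_of_unit : com_augmented u0.
Proof.
unshelve eexists.
  apply: (@OperadMorphism k (Com k) P (fun n => @com_map n : {linear _ -> _})).
  - by rewrite /= /com_map scale1r com_elt1.
  - by move=> n x s; rewrite /= opactZ opact_com_elt.
  - move=> m n i x y; rewrite /= opcompZl opcompZr scalerA; congr (_ *: _).
    by apply: op_inj; rewrite op_opcomp graft_com_elt.
by rewrite /= /com_map scale1r.
Qed.

(** Since [mu] is [com_elt 2], both composites equal [com_elt 3]. *)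
Lemma is_2aunit_of_unit : is_2aunit u0 mu.
Proof.
split=> //; apply: op_inj.
by rewrite !op_opcomp /= -com_elt2 !graft_com_elt.
Qed.

End ComOfUnit.

(** * The symmetrized 2-unit and the conclusion *)

Section Symmetrization.

Variables (k : fieldType) (P : operad k) (u0 : P 0%N) (u2 : P 2%N).

Definition sym2 : P 2%N := 2^-1 *: (u2 + opact u2 (tperm ord0 ord_max)).

Lemma opact_sym2 : opact sym2 (tperm ord0 ord_max) = sym2.
Proof. by rewrite opactZ opactD opact_act tperm2 opact_id addrC. Qed.

(** The transposition exchanges the two unit laws of [u2], so each law of [sym2] is the average of
    two identities. *)
Lemma is_2unit_sym2 : 2%N \notin [pchar k] -> is_2unit u0 u2 ->
  is_2unit u0 sym2.
Proof.
move=> char2 [u2l u2r].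
have act1 (x : P 1%N) (s : 'S_1) : opact x s = x.
  rewrite (_ : s = 1%g) ?opact_id //; apply/permP => i.
  by rewrite perm1 [s i]ord1 [i]ord1.
have graft_act (i : 'I_2) (s : 'S_2) :
    opcomp i (opact u2 s) u0 = opcomp (s i) u2 u0.
  by rewrite -[u0 in LHS]opact_id opcomp_act; apply: act1.
have half (x : P 1%N) : 2^-1 *: (x + x) = x.
  by rewrite -mulr2n -scaler_nat scalerA mulVf ?scale1r.
split; rewrite opcompZl opcompDl graft_act ?tpermL ?tpermR u2l u2r; exact: half.
Qed.

End Symmetrization.

Lemma restr_eq0_of_GKdim_le3 (R : realType) (k : fieldType) (P : operad k)
    (u0 : P 0%N) (u2 : P 2%N) :
  is_2unit u0 u2 -> (GKdim P R <= (3 : R)%:E)%E ->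
  forall d (x : P d.+1), (2 <= d)%N ->
    (forall i, (i <= d)%N -> restr u0 i x = 0) -> x = 0.
Proof.
move=> hu2 GK3 d x le2d x0; apply/eqP/contraT => x_neq0.
(* The bound is used at [d.+1], the arity of [x], which is at least 3. *)
have := lt_le_trans (GKdim_gt R (dim_ge_bin hu2 x_neq0 x0)) GK3.
by rewrite lte_fin ltr_nat ltnNge ltnS le2d.
Qed.

Theorem proposition2p5 (R : realType) (k : fieldType) (P : operad k)
    (u0 : P 0%N) (u2 : P 2%N)
    (hchar : 2%N \notin [pchar k])
    (hu0 : is_unit0 u0) (hu2 : is_2unit u0 u2)
    (hGK : GKdim P R = (3 : R)%:E) :
  is_2aunit u0 (2^-1 *: (u2 + opact u2 (tperm ord0 ord_max)))
  /\ com_augmented u0.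
Proof.
have mu_unit := is_2unit_sym2 hchar hu2; have mu_sym := opact_sym2 u2.
have restr0 : forall d (x : P d.+1), (2 <= d)%N ->
    (forall i, (i <= d)%N -> restr u0 i x = 0) -> x = 0.
  by apply: (restr_eq0_of_GKdim_le3 (R := R) hu2); rewrite hGK.
split; first exact: (is_2aunit_of_unit mu_unit restr0).
exact: (com_augmented_of_unit mu_unit mu_sym restr0).
Qed.
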